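(* Let $u,v\in S_n$ be permutations with separated descents, i.e. there is an integer $k$ with $\mathrm{maxdes}(u)\le k\le\mathrm{mindes}(v)$. Then $$\mathfrak{S}_u(x)\cdot\mathfrak{S}_v(x,t)\in\sum_{w\in S_\infty}\mathbb{Z}_{\ge0}[t]\cdot\mathfrak{S}_w(x,t),$$ i.e. the product expands in the double Schubert polynomials $\mathfrak{S}_w(x,t)$ with coefficients that are polynomials in $t_1,t_2,\ldots$ with nonnegative integer coefficients.
   Context: $S_n$ is the group of permutations of $\{1,\ldots,n\}$, $S_\infty=\bigcup_n S_n$, $s_i=(i,i+1)$. $\mathrm{maxdes}(u)=\max\{i: u(i)>u(i+1)\}$, $\mathrm{mindes}(v)=\min\{i: v(i)>v(i+1)\}$, with $\mathrm{maxdes}(\mathrm{id})=0$, $\mathrm{mindes}(\mathrm{id})=+\infty$. The double Schubert polynomials $\mathfrak{S}_w(x,t)$, $w\in S_\infty$, are determined by $\mathfrak{S}_{n\cdots 21}(x,t)=\prod_{i+j\le n}(x_i-t_j)$ for all $n$, and $\partial_i\mathfrak{S}_w(x,t)=\mathfrak{S}_{ws_i}(x,t)$ whenever $w(i)>w(i+1)$, where $\partial_i f=\dfrac{f-f|_{x_i\leftrightarrow x_{i+1}}}{x_i-x_{i+1}}$. The single Schubert polynomial is $\mathfrak{S}_w(x)=\mathfrak{S}_w(x,0)$ (all $t_i=0$). $\mathbb{Z}_{\ge0}[t]$ denotes polynomials in $t_1,t_2,\ldots$ with nonnegative integer coefficients. *)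

(* Defs.v *)
From HB Require Import structures.
From mathcomp Require Import all_boot all_fingroup all_algebra.
From mathcomp Require Import finmap.
From mathcomp.multinomials Require Import monalg.
From Stdlib Require FunctionalExtensionality ProofIrrelevance.

Set Implicit Arguments.
Unset Strict Implicit.
Unset Printing Implicit Defensive.

Import GRing.Theory Num.Theory.

Local Open Scope ring_scope.

(* Everything is 0-based: S_n acts on {0, ..., n-1}, and [xvar i], [tvar j]  *)
(* are the variables x_(i+1), t_(j+1).  Only [maxdes] and [mindes] return    *)
(* 1-based positions, so that their values are the usual ones.               *)

Record Sinf : Type := MkSinf {
  sinf_fun :> nat -> nat;
  sinf_bij : bijective sinf_fun;
  sinf_fin : exists n, forall i, (n <= i)%N -> sinf_fun i = i
}.

Lemma Sinf_ext (v w : Sinf) : v =1 w -> v = w.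
Proof.
case: v w => [f bf ff] [g bg fg] /= eq_fg.
have {eq_fg} efg := FunctionalExtensionality.functional_extensionality _ _ eq_fg.
by case: g / efg bg fg => bg fg; congr MkSinf; apply: ProofIrrelevance.proof_irrelevance.
Qed.

Section Mul.
Variables v w : Sinf.

Fact sinf_mul_bij : bijective (v \o w).
Proof. exact: bij_comp (sinf_bij v) (sinf_bij w). Qed.

Fact sinf_mul_fin : exists n, forall i, (n <= i)%N -> (v \o w) i = i.
Proof.
have [[m hm] [n hn]] := (sinf_fin v, sinf_fin w).
by exists (maxn m n) => i; rewrite geq_max /= => /andP[lem len]; rewrite hn ?hm.
Qed.

(* (v w)(i) = v (w i); this is opposite to the product on 'S_n. *)
Definition sinf_mul : Sinf := MkSinf sinf_mul_bij sinf_mul_fin.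
End Mul.

Section OfPerm.
Variables (n : nat) (s : 'S_n).

Definition ext_perm (s : 'S_n) (i : nat) : nat :=
  if insub i is Some j then val (s j) else i.

Fact ext_permK (r : 'S_n) : cancel (ext_perm r) (ext_perm r^-1%g).
Proof.
move=> i; rewrite /ext_perm; case: (insubP _ i) => [j _ <-|/negbTE nlt].
  by rewrite valK permK.
by case: insubP => // j; rewrite nlt.
Qed.

Fact ext_perm_bij : bijective (ext_perm s).
Proof.
exists (ext_perm s^-1%g); first exact: ext_permK.
by move=> i; rewrite -{1}(invgK s) ext_permK.
Qed.

Fact ext_perm_fin : exists m, forall i, (m <= i)%N -> ext_perm s i = i.
Proof.
by exists n => i; rewrite leqNgt /ext_perm; case: insubP => // j ->.
Qed.

Definition sinf_of_perm : Sinf := MkSinf ext_perm_bij ext_perm_fin.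
End OfPerm.

Definition longest (n : nat) : 'S_n := perm (@rev_ord_inj n).

Definition swap_nat (i j : nat) : nat :=
  if j == i then i.+1 else if j == i.+1 then i else j.

Fact swap_natK i : involutive (swap_nat i).
Proof.
move=> j; rewrite /swap_nat; have [->|ji] := eqVneq j i.
  by rewrite eqn_leq ltnn eqxx.
by have [->|/negbTE jSi] := eqVneq j i.+1; rewrite ?eqxx // (negbTE ji) jSi.
Qed.

Fact swap_nat_fin i : exists n, forall j, (n <= j)%N -> swap_nat i j = j.
Proof.
exists i.+2 => j lt_ij; rewrite /swap_nat.
by rewrite !gtn_eqF // ltnW.
Qed.

Definition sinf_adj (i : nat) : Sinf := MkSinf (inv_bij (swap_natK i)) (swap_nat_fin i).

Definition maxdes n (u : 'S_n) : nat :=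
  \max_(i < n | (ext_perm u i.+1 < ext_perm u i)%N) i.+1.

(* [None] stands for +oo. *)
Definition mindes n (v : 'S_n) : option nat :=
  let des i := (ext_perm v i.+1 < ext_perm v i)%N in
  if has des (iota 0 n) then Some (find des (iota 0 n)).+1 else None.

Definition leq_oo (k : nat) (m : option nat) : bool :=
  if m is Some m' then (k <= m')%N else true.

(* Z[x_1, x_2, ...; t_1, t_2, ...]: [inl i] indexes x's and [inr j] t's. *)
Definition polyxt : comNzRingType := {malg int[{cmonom (nat + nat)%type}]}.

Definition pvar (a : nat + nat) : polyxt := << ucm a >>.
Definition xvar (i : nat) : polyxt := pvar (inl i).
Definition tvar (j : nat) : polyxt := pvar (inr j).

Definition mon_subst (h : nat + nat -> polyxt) (m : {cmonom (nat + nat)%type}) :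
    polyxt :=
  \prod_(a <- finsupp m) h a ^+ m a.

Section Psubst.
Variable h : nat + nat -> polyxt.

Lemma mon_substEw (m : {cmonom (nat + nat)%type}) (d : {fset nat + nat}) :
  (finsupp m `<=` d)%fset -> mon_subst h m = \prod_(a <- d) h a ^+ m a.
Proof.
move=> le_md; rewrite /mon_subst (big_fset_incl _ le_md) // => a _ am.
by rewrite (fsfun_dflt am).
Qed.

Fact mon_subst_mmorphism : mmorphism (mon_subst h).
Proof.
split=> [m1 m2|]; last by rewrite /mon_subst mdom1 big_seq_fset0.
rewrite (mon_substEw (fsubsetUl (finsupp m1) (finsupp m2))).
rewrite (mon_substEw (fsubsetUr (finsupp m1) (finsupp m2))).
rewrite /mon_subst mdomD -big_split /=.
by apply: eq_bigr => a _; rewrite cmM exprD.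
Qed.

HB.instance Definition _ := isMultiplicative.Build _ _ (mon_subst h)
  mon_subst_mmorphism.

Definition psubst : {rmorphism polyxt -> polyxt} := mmap intr (mon_subst h).

Lemma psubst_pvar a : psubst (pvar a) = h a.
Proof.
rewrite /psubst /pvar /= mmapU /= mul1r /mon_subst mdomU.
by rewrite big_seq_fset1 cmUU expr1.
Qed.
End Psubst.

Definition swapx (i : nat) : {rmorphism polyxt -> polyxt} :=
  psubst (fun a => if a is inl j then xvar (swap_nat i j) else pvar a).

Definition set_t0 : {rmorphism polyxt -> polyxt} :=
  psubst (fun a => if a is inl _ then pvar a else 0).

Lemma swapx_xvar i j : swapx i (xvar j) = xvar (swap_nat i j).
Proof. exact: psubst_pvar. Qed.

Lemma swapx_tvar i j : swapx i (tvar j) = tvar j.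
Proof. exact: psubst_pvar. Qed.

Lemma set_t0_xvar i : set_t0 (xvar i) = xvar i.
Proof. exact: psubst_pvar. Qed.

Lemma set_t0_tvar j : set_t0 (tvar j) = 0.
Proof. exact: psubst_pvar. Qed.

(* g is the divided difference of f; as the ring is a domain, there is at   *)
(* most one such g.                                                          *)
Definition is_divdiff (i : nat) (f g : polyxt) : Prop :=
  (xvar i - xvar i.+1) * g = f - swapx i f.

(* The defining conditions of w |-> S_w(x,t).  They determine S, since       *)
(* every w is reached from some [longest n] by right multiplications by      *)
(* adjacent transpositions at descents.                                      *)
Definition double_schubert (S : Sinf -> polyxt) : Prop :=
  (forall n, S (sinf_of_perm (longest n)) =
     \prod_(i < n) \prod_(j < n | (i.+1 + j.+1 <= n)%N) (xvar i - tvar j)) /\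
  (forall (w : Sinf) (i : nat), (w i.+1 < w i)%N ->
     is_divdiff i (S w) (S (sinf_mul w (sinf_adj i)))).

(* Membership in the subsemiring Z_{>=0}[t]. *)
Definition nonneg_t (f : polyxt) : Prop :=
  forall m : {cmonom (nat + nat)%type}, 0 <= f@_m /\
    (f@_m != 0 -> forall i : nat, m (inl i) = 0%N).

(* Main.v *)
Require Import Defs.
From HB Require Import structures.
From mathcomp Require Import all_boot all_fingroup all_algebra.
From mathcomp Require Import finmap.
From mathcomp.multinomials Require Import monalg.
From mathcomp Require Import ring zify.
From Stdlib Require Import ClassicalEpsilon.

(* Let C be the set of N[t]-combinations of the S_w(x,t). It is stable under the
   divided differences d_i. It is also stable under multiplication by x_1...x_k:
   as x_i d_i f = f + d_i (x_(i+1) f), and as x_A commutes with d_i if A contains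
   both or none of i and i+1, one can raise w to a longest element w_0 at the cost
   of replacing A = {1,...,k} by other sets. The product x_A S_(w_0) is obtained
   from the next longest element by applying, row by row, d_i or 1 + t_j d_i.

   If u(a) = 1, removing this value from u and lowering the others gives a
   permutation u' of one letter less. If u' is increasing from position m on,
   S_u(x) = d_a ... d_(m-1) (x_1...x_(m-1) S_u'(x)). When the descents of u are
   at most k, one may take m = k (if a <= k, m = a = k+1 otherwise), and u' has
   its descents at most m-1. As S_v(x,t) is symmetric in x_1,...,x_k,
   S_u(x) S_v(x,t) = d_a ... d_(m-1) (x_1...x_(m-1) S_u'(x) S_v(x,t)), and
   S_u'(x) S_v(x,t) is in C by induction. *)

Import GRing.Theory Num.Theory.

Local Open Scope ring_scope.

(** * Substitutions and coefficients in Z[x;t]; regularity of x_i - x_(i+1) *)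

Lemma psubstE h p : psubst h p = \sum_(m <- msupp p) (p@_m)%:~R * mon_subst h m.
Proof. exact: erefl. Qed.

Lemma rmorph_psubst (f : {rmorphism polyxt -> polyxt}) h p :
  f (psubst h p) = psubst (fun a => f (h a)) p.
Proof.
rewrite [in LHS]psubstE [RHS]psubstE rmorph_sum; apply: eq_bigr => m _.
rewrite rmorphM rmorph_int /mon_subst rmorph_prod; congr (_ * _).
by apply: eq_bigr => a _; rewrite rmorphXn.
Qed.

Lemma eq_psubst g h p : g =1 h -> psubst g p = psubst h p.
Proof.
move=> e; rewrite [LHS]psubstE [RHS]psubstE; apply: eq_bigr => m _.
suff -> : mon_subst g m = mon_subst h m by [].
by rewrite /mon_subst; apply: eq_bigr => a _; rewrite e.
Qed.

Definition xtmonom (m : {cmonom (nat + nat)%type}) : polyxt := << m >>.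

Lemma xtmonomM m1 m2 : xtmonom (mmul m1 m2) = xtmonom m1 * xtmonom m2.
Proof. by rewrite /xtmonom malgM_def fgmulUU mulr1. Qed.

Lemma xtmonomX a k : exists2 q, pvar a ^+ k = xtmonom q & forall b, q b = (k * (a == b))%N.
Proof.
elim: k => [|k [q e1 e2]]; first by exists mone => // b; rewrite cm1.
exists (mmul (ucm a) q); first by rewrite xtmonomM exprS e1.
by move=> b; rewrite cmM cmU e2 mulSn.
Qed.

Lemma mon_subst_pvar m : mon_subst pvar m = xtmonom m.
Proof.
have prodE (s : seq (nat + nat)) : exists2 q, \prod_(a <- s) pvar a ^+ m a = xtmonom q &
    forall b, q b = (\sum_(a <- s) m a * (a == b))%N.
  elim: s => [|a s [q e1 e2]].
    by exists mone => [|b]; rewrite big_nil ?cm1.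
  have [q' e3 e4] := xtmonomX a (m a).
  exists (mmul q' q) => [|b]; first by rewrite big_cons e1 e3 xtmonomM.
  by rewrite big_cons cmM e4 e2.
rewrite /mon_subst; have [q -> eq] := prodE (finsupp m).
congr xtmonom; apply/eqP/cmP => b; rewrite eq.
have [bm|bm] := boolP (b \in finsupp m).
  rewrite (big_fsetD1 b) //= eqxx muln1 big_seq big1 ?addn0 // => a.
  by rewrite in_fsetD1 => /andP[/negbTE->]; rewrite muln0.
rewrite big_seq big1 ?(fsfun_dflt bm) // => a am.
by case: eqP => [e|]; rewrite ?muln0 //; rewrite -e am in bm.
Qed.

Lemma mcoeffMz m (p : polyxt) (z : int) : (p *~ z)@_m = p@_m *~ z.
Proof. exact: raddfMz. Qed.

Lemma mcoeff_sum I (r : seq I) (F : I -> polyxt) m :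
  (\sum_(i <- r) F i)@_m = \sum_(i <- r) (F i)@_m.
Proof. exact: raddf_sum. Qed.

Lemma mcoeff_xtmonom m q : (xtmonom m)@_q = (m == q)%:R.
Proof. exact: mcoeffU1. Qed.

Lemma mcoeff_xtmonomMz m q z : (xtmonom m *~ z)@_q = z *+ (m == q).
Proof.
by rewrite mcoeffMz mcoeff_xtmonom; case: (m == q); rewrite ?intz ?mul0rz.
Qed.

Lemma polyxtE (p : polyxt) : p = \sum_(m <- msupp p) xtmonom m *~ p@_m.
Proof.
rewrite [LHS]monalgE; apply: eq_bigr => m _; apply/malgP => q.
exact: etrans (mcoeffU _ _ _) (esym (mcoeff_xtmonomMz _ _ _)).
Qed.

Lemma psubst_id p : psubst pvar p = p.
Proof.
rewrite psubstE [RHS]polyxtE; apply: eq_bigr => m _.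
by rewrite mon_subst_pvar mulrzl.
Qed.

(** Exponents of [k] can be cancelled, so multiplication by a monomial only shifts coefficients; in
    particular a variable is not a zero divisor. *)
Lemma mcoeff_xtmonomM k m (p : polyxt) : (xtmonom k * p)@_(mmul k m) = p@_m.
Proof.
rewrite [in LHS](polyxtE p) mulr_sumr mcoeff_sum.
have E q : (xtmonom k * (xtmonom q *~ p@_q))@_(mmul k m) = p@_q *+ (q == m).
  rewrite mulrzAr -xtmonomM mcoeff_xtmonomMz; congr (_ *+ nat_of_bool _).
  apply/cmP/eqP => [e|-> //]; apply/eqP/cmP => b.
  by have := e b; rewrite !cmM => /addnI.
rewrite (eq_bigr _ (fun q _ => E q)).
have [pm|/mcoeff_outdom pm] := boolP (m \in msupp p).
  rewrite (big_fsetD1 m) // eqxx big_seq big1 => [|q]; first exact: addr0.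
  by rewrite in_fsetD1 => /andP[/negbTE-> _].
rewrite pm big1 // => q _.
by case: eqP => [->|_]; rewrite ?pm ?mul0rn.
Qed.

Lemma mulpvar_eq0 a (g : polyxt) : pvar a * g = 0 -> g = 0.
Proof.
by move=> e; apply/malgP => m; rewrite -(mcoeff_xtmonomM (ucm a)) e !mcoeff0.
Qed.

Lemma rmorph_subK (R : comNzRingType) (s : {rmorphism R -> R}) x y :
  s x = x - y -> s y = y -> s (x + y) = x.
Proof. by move=> sx sy; rewrite rmorphD sx sy subrK. Qed.

(** The injective map [s] sends [x - y] to [x], which is regular by assumption. *)
Lemma lreg_sub (R : comNzRingType) (s t : {rmorphism R -> R}) x y :
    cancel s t -> s x = x + y -> s y = y -> (forall g, x * g = 0 -> g = 0) ->
  GRing.lreg (x - y).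
Proof.
move=> sK sx sy regx f g /(congr1 s); rewrite !rmorphM rmorphB sx sy addrK => /eqP.
rewrite -subr_eq0 -mulrBr => /eqP/regx/eqP; rewrite subr_eq0 => /eqP.
exact: can_inj sK _ _.
Qed.

Lemma subxvar_lreg i : GRing.lreg (xvar i - xvar i.+1).
Proof.
(* The translation x_i -> x_i + y fixes the other variables; y = -x_(i+1) undoes y = x_(i+1). *)
pose h y a := if a == inl i then xvar i + y else pvar a.
have hi y : psubst (h y) (xvar i) = xvar i + y by rewrite psubst_pvar /h eqxx.
have hS y : psubst (h y) (xvar i.+1) = xvar i.+1.
  by rewrite psubst_pvar /h (inj_eq inl_inj) (gtn_eqF (ltnSn i)).
have hK p : psubst (h (- xvar i.+1)) (psubst (h (xvar i.+1)) p) = p.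
  rewrite -[RHS]psubst_id [LHS]rmorph_psubst; apply: eq_psubst => a.
  rewrite {2}/h; case: eqP => [->|/eqP/negbTE na].
    exact: rmorph_subK (hi _) (hS _).
  by rewrite psubst_pvar /h na.
exact: lreg_sub hK (hi _) (hS _) (@mulpvar_eq0 _).
Qed.

(** * Permutations of finite support and induction on the first ascent *)

Definition fixed_from (n : nat) (w : Sinf) := forall i, (n <= i)%N -> w i = i.

Definition Smul (w : Sinf) i := sinf_mul w (sinf_adj i).

Lemma swap_natl i : swap_nat i i = i.+1.
Proof. by rewrite /swap_nat eqxx. Qed.

Lemma swap_natr i : swap_nat i i.+1 = i.
Proof. by rewrite /swap_nat eqxx gtn_eqF. Qed.

Lemma swap_natD i j : j != i -> j != i.+1 -> swap_nat i j = j.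
Proof. by rewrite /swap_nat => /negbTE-> /negbTE->. Qed.

Lemma swap_natP i j :
  [\/ j = i /\ swap_nat i j = i.+1, j = i.+1 /\ swap_nat i j = i |
      [/\ j <> i, j <> i.+1 & swap_nat i j = j]].
Proof.
have [->|ji] := eqVneq j i; first by constructor 1; rewrite swap_natl.
have [->|jSi] := eqVneq j i.+1; first by constructor 2; rewrite swap_natr.
by constructor 3; rewrite swap_natD //; split=> //; apply/eqP.
Qed.

Lemma SmulE (w : Sinf) i j : Smul w i j = w (swap_nat i j).
Proof. by []. Qed.

Lemma SmulK (w : Sinf) i : Smul (Smul w i) i = w.
Proof. by apply: Sinf_ext => j; rewrite !SmulE swap_natK. Qed.

Lemma Sinf_inj {w : Sinf} : injective w.
Proof. exact: bij_inj (sinf_bij w). Qed.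

Lemma fixed_from_lt {n w} i : fixed_from n w -> (i < n)%N -> (w i < n)%N.
Proof.
move=> fw lt_in; rewrite ltnNge; apply/negP => le_nw.
by have e := Sinf_inj _ _ (fw _ le_nw); rewrite e leqNgt lt_in in le_nw.
Qed.

Lemma fixed_from_Smul {n w} i : fixed_from n w -> (i.+1 < n)%N -> fixed_from n (Smul w i).
Proof.
by move=> fw lt_in j le_nj; rewrite SmulE swap_natD ?fw //; apply/eqP; lia.
Qed.

Definition Slongest n := sinf_of_perm (longest n).

Lemma SlongestE n i : Slongest n i = if (i < n)%N then (n - i.+1)%N else i.
Proof.
rewrite /= /ext_perm; case: insubP => [j -> <-|/negbTE-> //].
by rewrite permE.
Qed.

Lemma decreasing_lt {w : Sinf} {i} : (forall j, (j < i)%N -> (w j.+1 < w j)%N) ->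
  forall p, (p < i)%N -> (w i < w p)%N.
Proof.
elim: i => // i IH dec p; rewrite ltnS leq_eqVlt => /predU1P[->|lt_pi].
  exact: dec.
apply: ltn_trans (dec i _) _ => //; apply: IH => // j lt_ji.
by apply: dec; apply: ltnW.
Qed.

(** Values drop by at least one per step. Counting from the left gives w i <= n-1-i ([up]), counting
    from the right gives w i >= n-1-i ([lo]). *)
Lemma decreasing_Slongest {n w} : fixed_from n w ->
  (forall i, (i.+1 < n)%N -> (w i.+1 < w i)%N) -> w = Slongest n.
Proof.
move=> fw dec; apply: Sinf_ext => i; rewrite SlongestE.
case: ltnP => [lt_in|/fw //].
have up j : (j < n)%N -> (w j + j < n)%N.
  elim: j => [|j IH] lt_jn; first by rewrite addn0 fixed_from_lt.
  have := dec _ lt_jn; have := IH (ltnW lt_jn); lia.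
have lo d : (d < n)%N -> (d <= w (n - d.+1))%N.
  elim: d => // d IH lt_dn; have := dec (n - d.+2)%N.
  have -> : ((n - d.+2).+1 = n - d.+1)%N by lia.
  by have := IH (ltnW lt_dn); lia.
have := up i lt_in; have := lo (n - i.+1)%N.
have -> : (n - (n - i.+1).+1 = i)%N by lia.
lia.
Qed.

Lemma big_nat_pair {R : Type} {idx : R} {op : Monoid.law idx} (F : nat -> R) {i n} :
    (i.+1 < n)%N ->
  \big[op/idx]_(0 <= j < n) F j =
  op (\big[op/idx]_(0 <= j < i) F j)
     (op (F i) (op (F i.+1) (\big[op/idx]_(i.+2 <= j < n) F j))).
Proof.
move=> lt_in; rewrite (big_cat_nat (n := i)) //=; last by lia.
by rewrite [X in op _ X]big_ltn ?[X in op _ (op _ X)]big_ltn //; lia.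
Qed.

(* [Smul w i] has more inversions than [w]; the sum of [i * w i] decreases. *)
Lemma Sinf_ind_first_ascent n (P : Sinf -> Prop) :
    P (Slongest n) ->
    (forall w i, fixed_from n w -> (i.+1 < n)%N -> (w i < w i.+1)%N ->
       (forall j, (j < i)%N -> (w j.+1 < w j)%N) -> P (Smul w i) -> P w) ->
  forall w, fixed_from n w -> P w.
Proof.
move=> P0 PS w; have [m] := ubnP (\sum_(0 <= i < n) i * w i)%N.
elim: m w => // m IH w lt_wm fw.
have [/existsP[i0 asc0]|none] := boolP [exists i : 'I_n, (i.+1 < n) && (w i < w i.+1)]%N.
  have ex : exists i, ((i.+1 < n) && (w i < w i.+1))%N by exists i0.
  case: (ex_minnP ex) => i /andP[lt_in asc] min_i.
  have first j : (j < i)%N -> (w j.+1 < w j)%N.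
    move=> lt_ji; rewrite ltnNge leq_eqVlt; apply/negP => /predU1P[/Sinf_inj|lt_w].
      lia.
    have /min_i : ((j.+1 < n) && (w j < w j.+1))%N by rewrite lt_w andbT; lia.
    lia.
  apply: (PS w i) => //; apply: IH; last exact: fixed_from_Smul.
  rewrite -ltnS; apply: leq_trans lt_wm; rewrite ltnS.
  have E (u : Sinf) : (\sum_(0 <= j < n) j * u j = \sum_(0 <= j < i) j * u j
      + (i * u i + (i.+1 * u i.+1 + \sum_(i.+2 <= j < n) j * u j)))%N.
    exact: (big_nat_pair _ lt_in).
  rewrite !E {E} !SmulE swap_natl swap_natr.
  have -> : (\sum_(0 <= j < i) j * Smul w i j = \sum_(0 <= j < i) j * w j)%N.
    by apply: eq_big_nat => j lt_j; rewrite SmulE swap_natD //; lia.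
  have -> : (\sum_(i.+2 <= j < n) j * Smul w i j = \sum_(i.+2 <= j < n) j * w j)%N.
    by apply: eq_big_nat => j lt_j; rewrite SmulE swap_natD //; lia.
  nia.
have {none} dec i : (i.+1 < n)%N -> (w i.+1 < w i)%N.
  move=> lt_in; rewrite ltnNge leq_eqVlt; apply/negP => /predU1P[/Sinf_inj|lt_w].
    lia.
  by move/existsPn/(_ (Ordinal (ltnW lt_in))): none; rewrite /= lt_in lt_w.
by rewrite (decreasing_Slongest fw dec).
Qed.

(** * Inserting a new least value *)

Section Insert0.

Variables (j : nat) (u : Sinf).

(** In one-line notation: the values of [u] are raised by one and 0 is put at position [j]. This
    inverts the removal of the least value. *)
Definition insert0_fun i := if i == j then 0%N else (u (unbump j i)).+1.

Fact insert0_bij : bijective insert0_fun.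
Proof.
have [v uK vK] := sinf_bij u.
exists (fun y => if y is y'.+1 then bump j (v y') else j) => [i|[|y]].
- rewrite /insert0_fun; have [->//|ij] := eqVneq i j.
  by rewrite uK unbumpKcond (negbTE ij).
- by rewrite /insert0_fun eqxx.
- by rewrite /insert0_fun eq_sym (negbTE (neq_bump _ _)) bumpK vK.
Qed.

Fact insert0_fin : exists n, forall i, (n <= i)%N -> insert0_fun i = i.
Proof.
have [n fu] := sinf_fin u; exists (maxn n j).+1 => i le_i.
by rewrite /insert0_fun /unbump gtn_eqF ?fu; lia.
Qed.

Definition insert0 : Sinf := MkSinf insert0_bij insert0_fin.

Lemma insert0_eq : insert0 j = 0%N.
Proof. by rewrite /= /insert0_fun eqxx. Qed.

Lemma insert0_lt i : (i < j)%N -> insert0 i = (u i).+1.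
Proof. by move=> lt_ij; rewrite /= /insert0_fun /unbump ltn_eqF // ltnNge ltnW // subn0. Qed.

Lemma insert0_ge i : (j <= i)%N -> insert0 i.+1 = (u i).+1.
Proof. by move=> le_ji; rewrite /= /insert0_fun /unbump gtn_eqF ltnS le_ji ?subn1. Qed.

End Insert0.

(** The last case displays the index as a successor, the form in which [insert0_ge] evaluates. *)
Variant cut_spec (j : nat) : nat -> Type :=
| CutLt i of (i < j)%N : cut_spec j i
| CutEq : cut_spec j j
| CutGt i of (j <= i)%N : cut_spec j i.+1.

Lemma cutP j i : cut_spec j i.
Proof.
case: (ltngtP i j) => [lt_ij|lt_ji|->]; [exact: CutLt | | exact: CutEq].
by case: i lt_ji => // i; rewrite ltnS; apply: CutGt.
Qed.

Lemma insert0_Slongest n : insert0 n (Slongest n) = Slongest n.+1.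
Proof.
apply: Sinf_ext => i; rewrite [RHS]SlongestE.
case: (cutP n i) => [{}i lt_in||{}i le_ni].
- by rewrite insert0_lt // SlongestE lt_in leqW //; lia.
- by rewrite insert0_eq ltnSn subnn.
- by rewrite insert0_ge // SlongestE ltnS !ltnNge le_ni.
Qed.

Lemma insert0_Smul {n i} u : (i.+1 < n)%N ->
  insert0 n (Smul u i) = Smul (insert0 n u) i.
Proof.
move=> lt_in; apply: Sinf_ext => j; rewrite [RHS]SmulE.
case: (cutP n j) => [{}j lt_jn||{}j le_nj].
- rewrite !insert0_lt ?SmulE //.
  by case: (swap_natP i j) => [[_ ->]|[_ ->]|[_ _ ->]]; lia.
- by rewrite swap_natD ?insert0_eq //; lia.
- by rewrite swap_natD ?insert0_ge // ?SmulE ?swap_natD //; lia.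
Qed.

(** The value 0 at position j+1 makes j a descent, so each move of 0 to the left is one divided
    difference of Schubert polynomials. *)
Lemma insert0_move j u : insert0 j u = Smul (insert0 j.+1 u) j.
Proof.
apply: Sinf_ext => i; rewrite [RHS]SmulE.
case: (cutP j i) => [{}i lt_ij||{}i le_ji].
- by rewrite swap_natD ?insert0_lt //; lia.
- by rewrite swap_natl !insert0_eq.
- have [->|ij] := eqVneq i j; first by rewrite swap_natr insert0_ge // insert0_lt.
  by rewrite swap_natD ?insert0_ge //; lia.
Qed.

Lemma insert0_ex {n} {u : Sinf} : fixed_from n.+1 u ->
  exists a u', [/\ (a <= n)%N, fixed_from n u' & u = insert0 a u'].
Proof.
move=> fu; have [v uK vK] := sinf_bij u; pose a := v 0%N.
have ua : u a = 0%N by rewrite vK.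
have le_an : (a <= n)%N.
  rewrite leqNgt; apply/negP => lt_na.
  by have := fu _ lt_na; rewrite ua; lia.
have gt0 i : i != a -> (0 < u i)%N.
  by apply: contraNltn; rewrite leqn0 -ua => /eqP/Sinf_inj->.
have bij : bijective (fun i => (u (bump a i)).-1).
  exists (fun y => unbump a (v y.+1)) => [i|y].
    by rewrite prednK ?gt0 ?uK ?bumpK // eq_sym neq_bump.
  by rewrite unbumpK ?vK // inE; apply/eqP => /(congr1 u); rewrite vK ua.
have fin i : (n <= i)%N -> (u (bump a i)).-1 = i.
  by move=> le_ni; rewrite /bump (leq_trans le_an le_ni) fu.
exists a, (MkSinf bij (ex_intro _ n fin)); split=> //.
apply: Sinf_ext => i; case: (cutP a i) => [{}i lt_ia||{}i le_ai].
- by rewrite insert0_lt //= /bump leqNgt lt_ia prednK // gt0 // ltn_eqF.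
- by rewrite insert0_eq.
- by rewrite insert0_ge //= /bump le_ai prednK // gt0 // gtn_eqF.
Qed.

(** Decidable equality, here by excluded middle, serves to merge the index lists of two
    expansions. *)
Lemma Sinf_eqP : Equality.axiom (fun v w : Sinf => excluded_middle_informative (v = w) : bool).
Proof. by move=> v w; case: excluded_middle_informative; constructor. Qed.

HB.instance Definition _ := hasDecEq.Build Sinf Sinf_eqP.

Lemma sum_extend (V : nmodType) (T : eqType) (F : T -> V) (r s : seq T) :
  uniq r -> uniq s -> {subset r <= s} ->
  \sum_(i <- s) (if i \in r then F i else 0) = \sum_(i <- r) F i.
Proof.
move=> Ur Us rs; rewrite -big_mkcond -big_filter; apply: perm_big.
apply: uniq_perm; rewrite ?filter_uniq // => i; rewrite mem_filter.
by apply/andP/idP => [[]|ir] //; split=> //; apply: rs.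
Qed.

(** * Divided differences over a ring with swaps of adjacent variables *)

Section DividedDifferences.

Variables (R : comNzRingType) (x : nat -> R) (sw : nat -> {rmorphism R -> R}).
Hypothesis swK : forall i, involutive (sw i).
Hypothesis sw_x : forall i j, sw i (x j) = x (swap_nat i j).
Hypothesis regx : forall i, GRing.lreg (x i - x i.+1).

(** A relation, as quotients need not exist in [R]; [regx] makes the value unique. *)
Definition divdiff i (f g : R) := (x i - x i.+1) * g = f - sw i f.

Lemma divdiff_uniq i f g h : divdiff i f g -> divdiff i f h -> g = h.
Proof. by move=> fg fh; apply: (regx i); rewrite fg fh. Qed.

Lemma divdiff0 i f : sw i f = f -> divdiff i f 0.
Proof. by rewrite /divdiff => ->; rewrite mulr0 subrr. Qed.

Lemma divdiffD i f g f' g' : divdiff i f g -> divdiff i f' g' -> divdiff i (f + f') (g + g').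
Proof. by rewrite /divdiff rmorphD mulrDr => -> ->; ring. Qed.

Lemma divdiffM i c f g : sw i c = c -> divdiff i f g -> divdiff i (c * f) (c * g).
Proof. by rewrite /divdiff rmorphM mulrCA => -> ->; ring. Qed.

(** Both f - s_i f and x_i - x_(i+1) change sign under s_i, so their quotient is fixed. *)
Lemma divdiff_sym i f g : divdiff i f g -> sw i g = g.
Proof.
move=> fg; apply: (regx i); rewrite fg; have /(congr1 (sw i)) := fg.
rewrite rmorphM !rmorphB !sw_x swap_natl swap_natr swK => e.
by rewrite -[LHS]opprK -mulNr opprB e opprB.
Qed.

Lemma sw_xD i j : j != i -> j != i.+1 -> sw i (x j) = x j.
Proof. by move=> ji jSi; rewrite sw_x swap_natD. Qed.

Lemma sw_prod i F m n : (forall j, (m <= j < n)%N -> sw i (F j) = F j) ->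
  sw i (\prod_(m <= j < n) F j) = \prod_(m <= j < n) F j.
Proof. by move=> symF; rewrite rmorph_prod; apply: eq_big_nat. Qed.

(** * Schubert polynomials and the cone of their positive combinations *)

Definition is_schubert (t : nat -> R) (S : Sinf -> R) :=
  (forall n, S (Slongest n) =
     \prod_(i < n) \prod_(j < n | (i.+1 + j.+1 <= n)%N) (x i - t j)) /\
  (forall (w : Sinf) i, (w i.+1 < w i)%N -> divdiff i (S w) (S (Smul w i))).

(** Applied to t -> 0, this shows that the single Schubert polynomials satisfy the same axioms with
    t = 0. *)
Lemma is_schubert_rmorph (s : {rmorphism R -> R}) (t t' : nat -> R) S :
    (forall i, s (x i) = x i) -> (forall j, s (t j) = t' j) ->
    (forall i f, s (sw i f) = sw i (s f)) ->
  is_schubert t S -> is_schubert t' (fun w => s (S w)).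
Proof.
move=> sx st s_sw [Slong Sdiv]; split=> [n|w i /Sdiv /(congr1 s)].
  rewrite Slong rmorph_prod; apply: eq_bigr => i _; rewrite rmorph_prod.
  by apply: eq_bigr => j _; rewrite rmorphB sx st.
by rewrite rmorphM !rmorphB !sx s_sw.
Qed.

Section Schubert.

Variables (t : nat -> R) (S : Sinf -> R).
Hypothesis sw_t : forall i j, sw i (t j) = t j.
Hypothesis schubS : is_schubert t S.

(** For l = n-1-i this is row [i] of the staircase product of [Slongest n]; [l] is left free so that
    rows can be shortened. *)
Definition row_prod i l := \prod_(0 <= j < l) (x i - t j).

Lemma row_prodS i l : row_prod i l.+1 = row_prod i l * (x i - t l).
Proof. by rewrite /row_prod big_nat_recr. Qed.

Lemma sw_row_prod i l : sw i (row_prod i l) = row_prod i.+1 l.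
Proof.
by rewrite rmorph_prod; apply: eq_bigr => j _; rewrite rmorphB sw_x sw_t swap_natl.
Qed.

Lemma sw_row_prodS i l : sw i (row_prod i.+1 l) = row_prod i l.
Proof. by rewrite -sw_row_prod swK. Qed.

Lemma sw_row_prodD i j l : j != i -> j != i.+1 -> sw i (row_prod j l) = row_prod j l.
Proof.
move=> ji jSi; rewrite rmorph_prod; apply: eq_bigr => k _.
by rewrite rmorphB sw_xD ?sw_t.
Qed.

Lemma schub_longest n : S (Slongest n) = \prod_(0 <= i < n) row_prod i (n - i.+1).
Proof.
rewrite (proj1 schubS) big_mkord; apply: eq_bigr => i _.
rewrite /row_prod big_mkord (big_ord_widen n (fun j => x i - t j)) ?leq_subr //.
by apply: eq_bigl => j; apply/idP/idP; lia.
Qed.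

Lemma schub_divdiff {w : Sinf} {i} : (w i < w i.+1)%N -> divdiff i (S (Smul w i)) (S w).
Proof.
move=> asc; rewrite -{2}(SmulK w i); apply: (proj2 schubS).
by rewrite !SmulE swap_natl swap_natr.
Qed.

Lemma schub_sym {w : Sinf} {i} : (w i < w i.+1)%N -> sw i (S w) = S w.
Proof. by move=> asc; apply: divdiff_sym (schub_divdiff asc). Qed.

(** The set C of N[t]-combinations, given by generators so that stability is proved by induction. *)
Inductive cone : R -> Prop :=
| cone_schub w : cone (S w)
| cone_0 : cone 0
| cone_add f g : cone f -> cone g -> cone (f + g)
| cone_mul j f : cone f -> cone (t j * f).

(** d_i is linear over the t_j and sends S_w to S_(w s_i) at a descent, to 0 at an ascent. By
    uniqueness it suffices to exhibit some divided difference in the cone. *)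
Lemma cone_divdiff i {f g} : divdiff i f g -> cone f -> cone g.
Proof.
move=> fg cf; suff [h fh ch] : exists2 h, divdiff i f h & cone h.
  by rewrite (divdiff_uniq _ _ _ _ fg fh).
elim: cf => {f g fg} [w||f f' _ [h fh ch] _ [h' fh' ch']|j f _ [h fh ch]].
- case: (ltngtP (w i) (w i.+1)) => [asc|desc|/Sinf_inj/eqP]; last 1 first.
  + by rewrite (ltn_eqF (ltnSn i)).
  + by exists 0; [apply/divdiff0/schub_sym | apply: cone_0].
  + by exists (S (Smul w i)); [apply: (proj2 schubS) | apply: cone_schub].
- by exists 0; [apply/divdiff0/rmorph0 | apply: cone_0].
- by exists (h + h'); [apply: divdiffD | apply: cone_add].
- by exists (t j * h); [apply: divdiffM | apply: cone_mul].
Qed.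

(** * Multiplication of the cone by products of variables *)

Definition xprod (A : pred nat) n := \prod_(0 <= i < n) (if A i then x i else 1).

Lemma cone_xprod_longest n A : cone (xprod A n * S (Slongest n)).
Proof.
(* [G m] interpolates: its first m rows are those of x_A S of [Slongest n], the others those of
   [Slongest n.+1]. *)
pose G m := \prod_(0 <= i < m) ((if A i then x i else 1) * row_prod i (n - i.+1)) *
            \prod_(m <= i < n.+1) row_prod i (n - i).
have G0 : cone (G 0%N).
  rewrite /G big_nil mul1r; suff -> : \prod_(0 <= i < n.+1) row_prod i (n - i) = S (Slongest n.+1).
    exact: cone_schub.
  by rewrite schub_longest; apply: eq_bigr => i _; rewrite subSS.
have GS m : (m < n)%N -> cone (G m) -> cone (G m.+1).
  move=> lt_mn cG; rewrite /G big_nat_recr //= -mulrA -mulrA.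
  set P := \prod_(0 <= i < m) _; set l := (n - m.+1)%N.
  pose Q := \prod_(m.+2 <= i < n.+1) row_prod i (n - i).
  (* Rows m and m+1 of [G m] have lengths l+1 and l. Without the factor x_m - t_l they are exchanged
     by the swap, so H is symmetric and d_m (G m) = H. *)
  pose H := P * (row_prod m l * row_prod m.+1 l) * Q.
  have GE : G m = (x m - t l) * H.
    rewrite /G (@big_ltn _ _ _ m); last exact: ltnW.
    rewrite (@big_ltn _ _ _ m.+1) // -/P -/l -/Q.
    have -> : (n - m = l.+1)%N by rewrite /l; lia.
    by rewrite row_prodS /H; ring.
  have symH : sw m H = H.
    rewrite !rmorphM sw_row_prod sw_row_prodS [row_prod m.+1 l * _]mulrC.
    rewrite [sw m P]sw_prod => [|j lt_j]; last first.
      by rewrite rmorphM sw_row_prodD; try lia; case: ifP => _; rewrite ?rmorph1 ?sw_xD //; lia.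
    by rewrite [sw m Q]sw_prod // => j lt_j; rewrite sw_row_prodD //; lia.
  have cH : cone H.
    apply: (cone_divdiff m) cG; rewrite GE /divdiff rmorphM rmorphB symH.
    by rewrite sw_x sw_t swap_natl; ring.
  rewrite (@big_ltn _ _ _ m.+1) // -/Q -/l.
  case: ifP => _; last by have -> : P * (1 * (row_prod m l * (row_prod m.+1 l * Q))) = H by rewrite /H; ring.
  (* This is (1 + t_l d_m) applied to [G m], as x_m = (x_m - t_l) + t_l. *)
  have -> : P * (x m * (row_prod m l * (row_prod m.+1 l * Q))) = G m + t l * H by rewrite GE /H; ring.
  by apply: cone_add => //; apply: cone_mul.
have Gm m : (m <= n)%N -> cone (G m).
  by elim: m => // m IH lt_mn; apply/GS/IH/ltnW.
have := Gm n (leqnn n); rewrite /G big_nat1 subnn /row_prod [X in _ * X]big_nil mulr1 big_split /=.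
by rewrite -[X in _ * X]schub_longest.
Qed.

(** [N] stands for nonnegativity of coefficients; only closure under 0, 1, sums and multiplication
    by t_j enters. *)
Lemma cone_expansion (N : R -> Prop) : N 0 -> N 1 ->
    (forall f g, N f -> N g -> N (f + g)) -> (forall j f, N f -> N (t j * f)) ->
  forall f, cone f -> exists (ws : seq Sinf) (c : Sinf -> R),
    (forall w, N (c w)) /\ f = \sum_(w <- ws) c w * S w.
Proof.
move=> N0 N1 ND Nt f cf.
suff [ws [c [_ Nc ->]]] : exists (ws : seq Sinf) (c : Sinf -> R),
    [/\ uniq ws, forall w, N (c w) & f = \sum_(w <- ws) c w * S w] by exists ws, c.
elim: cf => {f} [w||f g _ [ws [c [Us Nc ->]]] _ [ws' [c' [Us' Nc' ->]]]|j f _ [ws [c [Us Nc ->]]]].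
- by exists [:: w], (fun=> 1); split=> //; rewrite big_seq1 mul1r.
- by exists [::], (fun=> 0); split=> //; rewrite big_nil.
(* A coefficient function is arbitrary outside its own list, so it is cut to 0 there before
   adding. *)
- exists (undup (ws ++ ws')),
    (fun w => (if w \in ws then c w else 0) + (if w \in ws' then c' w else 0)).
  split=> [|w|]; first exact: undup_uniq.
    by apply: ND; case: ifP.
  rewrite -(sum_extend _ _ (fun w => c w * S w) ws (undup (ws ++ ws'))) ?undup_uniq //; last first.
    by move=> w; rewrite mem_undup mem_cat => ->.
  rewrite -(sum_extend _ _ (fun w => c' w * S w) ws' (undup (ws ++ ws'))) ?undup_uniq //; last first.
    by move=> w; rewrite mem_undup mem_cat orbC => ->.
  rewrite -big_split; apply: eq_bigr => w _ /=.
  by rewrite mulrDl; case: ifP; case: ifP; rewrite ?mul0r.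
- exists ws, (fun w => t j * c w); split=> // [w|]; first exact: Nt.
  by rewrite mulr_sumr; apply: eq_bigr => w _; rewrite mulrA.
Qed.

(* Pushing [A] past the first ascent of [w] keeps this condition true; without
   it the product need not be positive: [x_1 x_3 S_132 = S_3142 + S_2341 - S_321]. *)
Definition descending_gaps (A : pred nat) n (w : Sinf) :=
  forall p q a, (p <= q)%N -> (q < a)%N -> (a < n)%N -> ~~ A q -> A a -> (w a < w p)%N.

(** The delicate case is a gap q = i with p = i moved to i+1: then i+1 is also outside [A] and
    serves as the gap. *)
Lemma descending_gaps_same (A : pred nat) n (w : Sinf) i : (i.+1 < n)%N -> A i = A i.+1 ->
  descending_gaps A n w -> descending_gaps A n (Smul w i).
Proof.
move=> lt_in AiS gapA p q a le_pq lt_qa lt_an Aq Aa; rewrite !SmulE.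
have nqi : (q = i) -> ~~ A i.+1 by move=> e; rewrite -AiS -e.
case: (swap_natP i a) => [[ea ->]|[ea ->]|[ai aSi ->]].
- case: (swap_natP i p) => [[ep ->]|[ep ->]|[pi pSi ->]]; try lia.
  by apply: (gapA p q) => //; try lia; rewrite -AiS -ea.
- have qi : q <> i by move=> /nqi; rewrite -ea Aa.
  case: (swap_natP i p) => [[ep ->]|[ep ->]|[pi pSi ->]]; try lia.
  by apply: (gapA p q) => //; try lia; rewrite AiS -ea.
- case: (swap_natP i p) => [[ep ->]|[ep ->]|[pi pSi ->]].
  + have [e|ne] := eqVneq q i.
      by apply: (gapA _ i.+1) => //; [lia | apply: nqi].
    by apply: (gapA _ q) => //; lia.
  + by apply: (gapA _ q) => //; lia.
  + exact: (gapA _ q).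
Qed.

(** The new member i+1 gets the value w i, which is below w (i+1) by the ascent and below all
    earlier values because no ascent precedes. For members beyond i+1, the old gap i+1 replaces the
    new gap i. *)
Lemma descending_gaps_swap (A : pred nat) n (w : Sinf) i : (i.+1 < n)%N -> A i -> ~~ A i.+1 ->
    (w i < w i.+1)%N -> (forall p, (p < i)%N -> (w i < w p)%N) ->
    descending_gaps A n w ->
  descending_gaps (fun j => A (swap_nat i j)) n (Smul w i).
Proof.
move=> lt_in Ai ASi asc first gapA p q a le_pq lt_qa lt_an Aq Aa; rewrite !SmulE.
case: (swap_natP i a) Aa => [[ea ->]|[ea ->]|[ai aSi ->]] Aa.
- by rewrite Aa in ASi.
- case: (swap_natP i p) => [[ep ->]|[ep ->]|[pi pSi ->]]; try lia.
  by apply: first; lia.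
- have [lt_ai|lt_ia] : (a < i)%N \/ (i.+1 < a)%N by lia.
    rewrite swap_natD in Aq; try lia.
    by rewrite swap_natD; try lia; apply: (gapA p q).
  case: (swap_natP i p) => [[ep ->]|[ep ->]|[pi pSi ->]].
  + by apply: (gapA _ i.+1).
  + by apply: (gapA _ i.+1).
  + case: (swap_natP i q) Aq => [[eq ->]|[eq ->]|[qi qSi ->]] Aq.
    * by apply: (gapA _ i.+1) => //; lia.
    * by rewrite Ai in Aq.
    * by apply: (gapA _ q).
Qed.

(** A member above the new gap i lies beyond i+1, which was already a gap. *)
Lemma descending_gaps_remove (A : pred nat) n (w : Sinf) i : (i.+1 < n)%N -> A i -> ~~ A i.+1 ->
    descending_gaps A n w ->
  descending_gaps (fun j => A j && (j != i)) n (Smul w i).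
Proof.
move=> lt_in Ai ASi gapA p q a le_pq lt_qa lt_an Aq /andP[Aa ai]; rewrite !SmulE.
have aSi : a <> i.+1 by move=> e; rewrite -e Aa in ASi.
rewrite (swap_natD i a) //; last exact/eqP.
have {Aq}[Aq|eq] : ~~ A q \/ q = i.
- by move: Aq; rewrite negb_and negbK => /orP[|/eqP]; [left|right].
- have [lt_ai|lt_ia] : (a < i)%N \/ (i.+1 < a)%N by lia.
    by rewrite swap_natD; try lia; apply: (gapA p q).
  case: (swap_natP i p) => [[ep ->]|[ep ->]|[pi pSi ->]].
  + by apply: (gapA _ i.+1).
  + by apply: (gapA _ i.+1).
  + exact: (gapA _ q).
- case: (swap_natP i p) => [[ep ->]|[ep ->]|[pi pSi ->]].
  + by apply: (gapA _ i.+1) => //; lia.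
  + lia.
  + by apply: (gapA _ i.+1) => //; lia.
Qed.

Lemma cone_xprod_schub n w (A : pred nat) : fixed_from n w -> descending_gaps A n w ->
  cone (xprod A n * S w).
Proof.
move=> fw; elim/(Sinf_ind_first_ascent n): w / fw A => [A _|w i fw lt_in asc first IH A gapA].
  exact: cone_xprod_longest.
have {}first := decreasing_lt first.
pose E j := if A j then x j else 1.
pose L := \prod_(0 <= j < i) E j; pose M := \prod_(i.+2 <= j < n) E j.
have symE j : j != i -> j != i.+1 -> sw i (E j) = E j.
  by move=> ji jSi; rewrite /E; case: ifP => _; rewrite ?rmorph1 ?sw_xD.
have symL : sw i L = L by apply: sw_prod => j lt_j; apply: symE; lia.
have symM : sw i M = M by apply: sw_prod => j lt_j; apply: symE; lia.
have XE (B : pred nat) : (forall j, j != i -> j != i.+1 -> B j = A j) ->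
    xprod B n = L * M * ((if B i then x i else 1) * (if B i.+1 then x i.+1 else 1)).
  move=> AB; rewrite /xprod (big_nat_pair _ lt_in) /=.
  have -> : \prod_(0 <= j < i) (if B j then x j else 1) = L.
    by apply: eq_big_nat => j lt_j; rewrite AB //; lia.
  have -> : \prod_(i.+2 <= j < n) (if B j then x j else 1) = M.
    by apply: eq_big_nat => j lt_j; rewrite AB //; lia.
  by rewrite -/L; ring.
have dw := schub_divdiff asc.
have [AiS|nAiS] := eqVneq (A i) (A i.+1).
  (* x_A is symmetric in x_i and x_(i+1), so it passes through d_i. *)
  apply: (cone_divdiff i) (IH A (descending_gaps_same _ _ _ _ lt_in AiS gapA)).
  apply: divdiffM dw; rewrite XE // !rmorphM symL symM AiS; congr (_ * _).
  by case: ifP => _; rewrite ?rmorph1 // !sw_x swap_natl swap_natr mulrC.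
have [Ai|nAi] := boolP (A i); last first.
  (* A gap at i below the member i+1 would force w (i+1) < w i, against the ascent. *)
  have ASi : A i.+1 by move: nAiS; rewrite (negbTE nAi); case: (A i.+1).
  by have := gapA i i i.+1 (leqnn i) (ltnSn i) lt_in nAi ASi; lia.
have ASi : ~~ A i.+1 by move: nAiS; rewrite Ai; case: (A i.+1).
pose A' j := A (swap_nat i j); pose A'' j := A j && (j != i).
have c' : cone (xprod A' n * S (Smul w i)).
  exact: IH (descending_gaps_swap _ _ _ _ lt_in Ai ASi asc first gapA).
have c'' : cone (xprod A'' n * S (Smul w i)).
  exact: IH (descending_gaps_remove _ _ _ _ lt_in Ai ASi gapA).
have X' : xprod A' n = L * M * x i.+1.
  rewrite XE /A' ?swap_natl ?swap_natr ?Ai ?(negbTE ASi) ?mul1r // => j ji jSi.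
  by rewrite swap_natD.
have X'' : xprod A'' n = L * M.
  by rewrite XE /A'' ?eqxx ?andbF ?(negbTE ASi) ?mulr1 // => j -> _; rewrite andbT.
(* [x_i d_i f = f + d_i (x_(i+1) f)] *)
have -> : xprod A n * S w = xprod A'' n * S (Smul w i) +
    L * M * (x i * S w - S (Smul w i)).
  by rewrite X'' XE // Ai (negbTE ASi); ring.
apply: cone_add => //; apply: (cone_divdiff i) c'.
rewrite X' -mulrA; apply: divdiffM; first by rewrite rmorphM symL symM.
by rewrite /divdiff rmorphM sw_x swap_natr mulrBr mulrCA dw; ring.
Qed.

(** An initial segment has no gap below a member, so [descending_gaps] holds vacuously. *)
Lemma cone_initial_prod k f : cone f -> cone (\prod_(0 <= i < k) x i * f).
Proof.
elim=> [w||g h _ cg _ ch|j g _ cg].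
- have [n fw] := sinf_fin w; set N := maxn n k.
  have -> : \prod_(0 <= i < k) x i = xprod (fun i => (i < k)%N) N.
    have e1 : \prod_(k <= i < N) (if (i < k)%N then x i else 1) = 1.
      by rewrite big_nat big1 // => i /andP[le_ki _]; rewrite ltnNge le_ki.
    rewrite /xprod [RHS](big_cat_nat (n := k)) ?leq_maxr //= e1 mulr1.
    by apply: eq_big_nat => i /andP[_ ->].
  apply: cone_xprod_schub => [i le_i|p q a le_pq lt_qa _ Aq Aa]; last by lia.
  by apply: fw; apply: leq_trans le_i; apply: leq_maxl.
- by rewrite mulr0; apply: cone_0.
- by rewrite mulrDr; apply: cone_add.
- by rewrite mulrCA; apply: cone_mul.
Qed.

End Schubert.

(** * Single Schubert polynomials under insertion of a least value *)

Section SingleSchubert.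

Variable S0 : Sinf -> R.
Hypothesis schubS0 : is_schubert (fun=> 0) S0.

(** With t = 0, passing from [Slongest n] to [Slongest n.+1] adds one factor x_i to each of the
    first n rows. The product of these factors commutes with d_i for i+1 < n, which carries the
    identity down to [u]. *)
Lemma schub_insert0_last {n u} : fixed_from n u ->
  S0 (insert0 n u) = \prod_(0 <= i < n) x i * S0 u.
Proof.
move=> fu; elim/(Sinf_ind_first_ascent n): u / fu => [|w i fw lt_in asc _ IH].
  rewrite insert0_Slongest !(schub_longest _ _ schubS0) big_nat_recr //= subnn.
  rewrite {2}/row_prod big_nil mulr1 -big_split; apply: eq_big_nat => i lt_in.
  have -> : (n.+1 - i.+1 = (n - i.+1).+1)%N by lia.
  by rewrite row_prodS subr0 mulrC.
have asc' : (insert0 n w i < insert0 n w i.+1)%N by rewrite !insert0_lt // ltnW.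
apply: (divdiff_uniq i (S0 (insert0 n (Smul w i)))).
  by rewrite (insert0_Smul _ lt_in); apply: (schub_divdiff _ _ schubS0 asc').
rewrite IH; apply: divdiffM (schub_divdiff _ _ schubS0 asc).
rewrite (big_nat_pair _ lt_in) /= !rmorphM !sw_x swap_natl swap_natr.
rewrite [sw i (\prod_(0 <= j < i) _)]sw_prod => [|j lt_j]; last by rewrite sw_xD //; lia.
rewrite [sw i (\prod_(i.+2 <= j < n) _)]sw_prod => [|j lt_j]; last by rewrite sw_xD //; lia.
by rewrite [in LHS](mulrCA (x i.+1)).
Qed.

(** Start at position n and move 0 left. As [u] ascends at j, S_u is symmetric in x_j and x_(j+1),
    so d_j only removes the factor x_j. *)
Lemma schub_insert0 {n u} k j : fixed_from n u ->
    (forall i, (k <= i)%N -> (u i < u i.+1)%N) -> (k <= j <= n)%N ->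
  S0 (insert0 j u) = \prod_(0 <= i < j) x i * S0 u.
Proof.
move=> fu asc /andP[le_kj le_jn].
have [d ed] : exists d, (n = j + d)%N by exists (n - j)%N; lia.
elim: d j le_kj {le_jn} ed => [|d IH] j le_kj ed.
  by rewrite ed addn0 in fu; apply: schub_insert0_last.
apply: (divdiff_uniq j (S0 (insert0 j.+1 u))).
  rewrite (insert0_move j); apply: (proj2 schubS0).
  by rewrite insert0_eq insert0_lt.
rewrite (IH j.+1) ?big_nat_recr //=; [|lia|lia].
rewrite /divdiff !rmorphM sw_prod => [|i lt_ij]; last by rewrite sw_xD //; lia.
rewrite sw_x swap_natl (schub_sym _ _ schubS0 (asc _ le_kj)).
by ring.
Qed.

End SingleSchubert.

(** * Products with separated descents *)

Theorem cone_separated_descents (t : nat -> R) (S S0 : Sinf -> R) :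
    (forall i j, sw i (t j) = t j) -> is_schubert t S -> is_schubert (fun=> 0) S0 ->
  forall n (u v : Sinf) k, fixed_from n u -> (forall i, (k <= i)%N -> (u i < u i.+1)%N) ->
    (forall i, (i.+1 < k)%N -> (v i < v i.+1)%N) ->
  cone t S (S0 u * S v).
Proof.
move=> sw_t schubS schubS0 n u v; elim: n u => [|n IH] u k fu asc_u asc_v.
  have -> : S0 u = 1.
    rewrite (_ : u = Slongest 0) ?(schub_longest _ _ schubS0) ?big_nil //.
    by apply: Sinf_ext => i; rewrite SlongestE fu.
  by rewrite mul1r; apply: cone_schub.
(* Beyond n+1 the permutation [u] is the identity, so a larger k can be lowered to n+1. The bound
   keeps position k-1 within the range of [schub_insert0]. *)
wlog le_kn : k asc_u asc_v / (k <= n.+1)%N => [thm|].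
  have [le_kn|lt_nk] := leqP k n.+1; first exact: (thm k).
  apply: (thm n.+1) => // i le_i; last by apply: asc_v; lia.
  by rewrite !fu // ltnW.
have [a [u' [le_an fu' eu]]] := insert0_ex fu.
(* Otherwise u would ascend from position a-1 to the value 0. *)
have le_ak : (a <= k)%N.
  rewrite leqNgt; apply/negP => lt_ka; have := asc_u a.-1.
  by rewrite prednK ?eu ?insert0_eq; lia.
have asc_u' i : (a <= i)%N -> (k <= i.+1)%N -> (u' i < u' i.+1)%N.
  by move=> le_ai /asc_u; rewrite eu !insert0_ge ?ltnS // ltnW.
rewrite eu; have [e|lt_ak] := eqVneq a k.
  have asc i : (a <= i)%N -> (u' i < u' i.+1)%N by move=> le_ai; apply: asc_u'; lia.
  rewrite (schub_insert0 _ schubS0 a a fu' asc) ?leqnn // -mulrA.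
  by apply: cone_initial_prod => //; apply: (IH _ a) => // i; rewrite e; apply: asc_v.
have asc i : (k.-1 <= i)%N -> (u' i < u' i.+1)%N by move=> le_ki; apply: asc_u'; lia.
have [d ed] : exists d, (k.-1 = a + d)%N by exists (k.-1 - a)%N; lia.
have lt_ak' : (a < k)%N by lia.
(* The value 0 starts at position k-1 and moves left; [a] varies while [u'] stays fixed. *)
elim: d a ed lt_ak' {asc_u' eu le_an le_ak lt_ak} => [|d IHd] a ed lt_ak.
  have ea : a = k.-1 by lia.
  rewrite (schub_insert0 _ schubS0 _ a fu' asc); last by lia.
  rewrite -mulrA; apply: cone_initial_prod => //.
  by apply: (IH _ a) => // i lt_ia; [apply: asc; lia | apply: asc_v; lia].
(* Here a+1 < k, so S_v is symmetric in x_a and x_(a+1) and passes through d_a. *)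
apply: (cone_divdiff _ _ _ schubS a) (IHd a.+1 _ _) => //; try lia.
rewrite ![_ * S v]mulrC; apply: divdiffM.
  by apply: (schub_sym _ _ schubS); apply: asc_v; lia.
by rewrite (insert0_move a); apply: (proj2 schubS0); rewrite insert0_eq insert0_lt.
Qed.

End DividedDifferences.

(** * Nonnegativity in Z[x;t] and the result for the concrete polynomials *)

Lemma swapxK i : involutive (swapx i).
Proof.
move=> p; rewrite -[RHS]psubst_id [LHS]rmorph_psubst; apply: eq_psubst => -[j|j].
  by rewrite swapx_xvar swap_natK.
exact: swapx_tvar.
Qed.

Lemma set_t0_swapx i p : set_t0 (swapx i p) = swapx i (set_t0 p).
Proof.
rewrite [LHS]rmorph_psubst [RHS]rmorph_psubst; apply: eq_psubst => -[j|j].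
  exact: etrans (set_t0_xvar _) (esym (swapx_xvar _ _)).
exact: etrans (set_t0_tvar _) (esym (rmorph0 _)).
Qed.

Lemma nonneg_t0 : nonneg_t 0.
Proof. by move=> m; rewrite mcoeff0 eqxx. Qed.

Lemma nonneg_t1 : nonneg_t 1.
Proof.
move=> m; rewrite -[1]/(xtmonom mone) mcoeff_xtmonom; split; first exact: ler0n.
by case: (mone =P m) => [<- _ i|_]; rewrite ?cm1 ?eqxx.
Qed.

Lemma nonneg_tD f g : nonneg_t f -> nonneg_t g -> nonneg_t (f + g).
Proof.
move=> Nf Ng m; have [[f0 fs] [g0 gs]] := (Nf m, Ng m).
rewrite mcoeffD; split; first exact: addr_ge0.
by rewrite paddr_eq0 // negb_and => /orP[/fs|/gs].
Qed.

Lemma nonneg_t_tvarM j f : nonneg_t f -> nonneg_t (tvar j * f).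
Proof.
move=> Nf m; have -> : (tvar j * f)@_m =
    \sum_(q <- msupp f) f@_q *+ (mmul (ucm (inr j)) q == m).
  rewrite [in LHS](polyxtE f) mulr_sumr mcoeff_sum; apply: eq_bigr => q _.
  by rewrite mulrzAr -xtmonomM mcoeff_xtmonomMz.
split=> [|nz i]; first by apply: sumr_ge0 => q _; apply/mulrn_wge0/(proj1 (Nf q)).
(* Multiplication by t_j leaves exponents of the x_i unchanged, so a monomial containing x_i would
   have to come from one in [f]. *)
apply/eqP; apply: contraNT nz => mi; rewrite big_seq big1 // => q qf.
case: eqP => // e; move: mi; rewrite -e cmM cmU /= (proj2 (Nf q)) //.
by rewrite mcoeff_neq0.
Qed.

Theorem corollary6p5 (S : Sinf -> polyxt) (HS : double_schubert S)
    (n : nat) (u v : 'S_n) (k : nat)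
    (Hu : (maxdes u <= k)%N) (Hv : leq_oo k (mindes v)) :
  exists (ws : seq Sinf) (c : Sinf -> polyxt),
    (forall w, nonneg_t (c w)) /\
    set_t0 (S (sinf_of_perm u)) * S (sinf_of_perm v) = \sum_(w <- ws) c w * S w.
Proof.
have fixed (s : 'S_n) : fixed_from n (sinf_of_perm s).
  by move=> i; rewrite /= /ext_perm leqNgt; case: insubP => // j ->.
have asc (w : Sinf) i : ~~ (w i.+1 < w i)%N -> (w i < w i.+1)%N.
  rewrite -leqNgt leq_eqVlt => /predU1P[/Sinf_inj/eqP|//].
  by rewrite ltn_eqF.
(* A descent at the 0-based position i counts as i+1 in [maxdes], hence i < k. *)
have asc_u i : (k <= i)%N -> (sinf_of_perm u i < sinf_of_perm u i.+1)%N.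
  move=> le_ki; apply: asc; apply/negP => des.
  have [lt_in|le_ni] := ltnP i n; last by rewrite !fixed ?(leqW le_ni) ?ltnNge ?leqnSn // in des.
  have : (i.+1 <= maxdes u)%N.
    exact: (@leq_bigmax_cond _ _ (fun i : 'I_n => i.+1) (Ordinal lt_in)).
  by rewrite ltnNge (leq_trans Hu le_ki).
(* A descent at i would give [mindes] at most i+1; a descent with i+1 = k remains possible. *)
have asc_v i : (i.+1 < k)%N -> (sinf_of_perm v i < sinf_of_perm v i.+1)%N.
  move=> lt_ik; apply: asc; apply/negP => des.
  have [lt_in|le_ni] := ltnP i n; last by rewrite !fixed ?(leqW le_ni) ?ltnNge ?leqnSn // in des.
  move: Hv; rewrite /mindes; case: ifP => [_ /= le_k|/hasPn/(_ i)].
    have /(before_find 0%N) := leq_trans lt_ik le_k.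
    by rewrite nth_iota // add0n => /negbT/negP; apply.
  by rewrite mem_iota /= lt_in => /(_ isT); rewrite des.
have schubS : is_schubert polyxt xvar swapx tvar S by [].
have schubS0 := is_schubert_rmorph _ _ _ _ _ _ _ set_t0_xvar set_t0_tvar set_t0_swapx schubS.
apply: (cone_expansion _ tvar S nonneg_t nonneg_t0 nonneg_t1 nonneg_tD nonneg_t_tvarM).
exact: (cone_separated_descents _ _ _ swapxK swapx_xvar subxvar_lreg _ _ _ swapx_tvar
  schubS schubS0 n _ _ k (fixed u)).
Qed.
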